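(* Let $K$ be a perfect field, $k\subset K$ a subfield, and $\lambda\in\operatorname{Emb}(K)$ with $|\lambda^G|=n<\infty$. Let $\overline{\lambda}$ be an extension of $\lambda$ to $\overline{K}$ and $\mu=(\overline{\lambda})^{-1}|_K$. Suppose $[K(\lambda):\lambda(K)]$ is finite. Then ${}^*V(\lambda)\cong V(\lambda)^*\cong V(\mu)$, and $V(\lambda)$ has rank $n$ if and only if $V(\mu)$ has rank $n$ if and only if $[K(\lambda):\lambda(K)]=n$.
   Context: $\overline{K}$ is a fixed algebraic closure of $K$. A two-sided vector space is a $K\otimes_kK$-module; left (resp. right) multiplication by $K$ is the action of $K\otimes1$ (resp. $1\otimes K$); ${}_KV$, $V_K$ denote the restrictions of scalars; $V$ has rank $n$ if $\dim_K({}_KV)=\dim_K(V_K)=n$. $\operatorname{Emb}(K)$ is the set of $k$-linear field embeddings $K\to\overline{K}$; $G=\operatorname{Aut}(\overline{K}/K)$ acts by left composition, with orbits $\lambda^G$. For $\nu\in\operatorname{Emb}(K)$, $K(\nu)$ is the composite of $K$ and $\nu(K)$ in $\overline{K}$, and $V(\nu)$ is the two-sided vector space with underlying set $K(\nu)$ and action $a\cdot v\cdot b=av\nu(b)$. The right dual $V^*$ is $\operatorname{Hom}_K(V_K,K)$ with $(a\cdot\psi\cdot b)(x)=a\psi(bx)$; the left dual ${}^*V$ is $\operatorname{Hom}_K({}_KV,K)$ with $(a\cdot\phi\cdot b)(x)=b\phi(xa)$. *)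

(* Defs.v *)
From HB Require Import structures.
From mathcomp Require Import all_boot all_order all_algebra.
From Stdlib Require Import ProofIrrelevance.
Set Implicit Arguments. Unset Strict Implicit. Unset Printing Implicit Defensive.
Import GRing.Theory.
Local Open Scope ring_scope.

Definition perfect (K : fieldType) : Prop :=
  forall p : nat, p \in [pchar K] -> forall x : K, exists y : K, y ^+ p = x.

Definition is_algebraic_closure (K : fieldType) (Kbar : closedFieldType)
    (iota : {rmorphism K -> Kbar}) : Prop :=
  forall x : Kbar, exists p : {poly K}, p != 0 /\ root (map_poly iota p) x.

Definition is_k_emb (k K Kbar : fieldType) (kK : {rmorphism k -> K})
    (iota : {rmorphism K -> Kbar}) (nu : K -> Kbar) : Prop :=
  forall c : k, nu (kK c) = iota (kK c).

Definition in_Gal (K Kbar : fieldType) (iota : {rmorphism K -> Kbar})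
    (s : {rmorphism Kbar -> Kbar}) : Prop :=
  bijective s /\ forall a : K, s (iota a) = iota a.

Definition in_orbit (K Kbar : fieldType) (iota : {rmorphism K -> Kbar})
    (lam nu : K -> Kbar) : Prop :=
  exists s : {rmorphism Kbar -> Kbar}, in_Gal iota s /\ forall a, nu a = s (lam a).

Definition orbit_card (K Kbar : fieldType) (iota : {rmorphism K -> Kbar})
    (lam : K -> Kbar) (n : nat) : Prop :=
  exists f : 'I_n -> (K -> Kbar),
    (forall i, in_orbit iota lam (f i)) /\
    (forall nu, in_orbit iota lam nu -> exists i, forall a, nu a = f i a) /\
    (forall i j, (forall a, f i a = f j a) -> i = j).

Definition subfield_closed (L : fieldType) (P : L -> Prop) : Prop :=
  [/\ P 0, P 1, (forall x y, P x -> P y -> P (x - y)),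
      (forall x y, P x -> P y -> P (x * y)) & (forall x, P x -> P x^-1)].

Definition in_comp (K L : fieldType) (iota nu : K -> L) (x : L) : Prop :=
  forall P : L -> Prop, subfield_closed P ->
    (forall a, P (iota a)) -> (forall a, P (nu a)) -> P x.

Definition in_image (K L : fieldType) (nu : K -> L) (x : L) : Prop :=
  exists a, x = nu a.

Definition ext_degree (L : fieldType) (F E : L -> Prop) (n : nat) : Prop :=
  exists b : 'I_n -> L,
    (forall i, E (b i)) /\
    (forall x, E x -> exists c : 'I_n -> L,
        (forall i, F (c i)) /\ x = \sum_(i < n) c i * b i) /\
    (forall c : 'I_n -> L, (forall i, F (c i)) ->
        \sum_(i < n) c i * b i = 0 -> forall i, c i = 0).

Definition finite_degree (L : fieldType) (F E : L -> Prop) : Prop :=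
  exists n, ext_degree F E n.

Record tsv (K : fieldType) := TSV {
  tcar :> Type;
  tzero : tcar;
  tadd : tcar -> tcar -> tcar;
  tl : K -> tcar -> tcar;
  tr : tcar -> K -> tcar }.

(** The bimodule laws needed to form the duals. *)
Definition bimod_compat (K : fieldType) (V : tsv K) : Prop :=
  [/\ (forall (a : K) (u v : V), tl a (tadd u v) = tadd (tl a u) (tl a v)),
      (forall (b : K) (u v : V), tr (tadd u v) b = tadd (tr u b) (tr v b)) &
      (forall (a b : K) (v : V), tl a (tr v b) = tr (tl a v) b)].

Definition tsv_iso (K : fieldType) (V W : tsv K) : Prop :=
  exists (f : V -> W) (g : W -> V),
    [/\ cancel f g, cancel g f,
        (forall u v : V, f (tadd u v) = tadd (f u) (f v)),
        (forall (a : K) (v : V), f (tl a v) = tl a (f v)) &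
        (forall (v : V) (b : K), f (tr v b) = tr (f v) b)].

Definition ldim_eq (K : fieldType) (V : tsv K) (n : nat) : Prop :=
  exists b : 'I_n -> V,
    (forall v : V, exists c : 'I_n -> K,
        v = \big[@tadd K V / tzero V]_(i < n) tl (c i) (b i)) /\
    (forall c c' : 'I_n -> K,
        \big[@tadd K V / tzero V]_(i < n) tl (c i) (b i) =
        \big[@tadd K V / tzero V]_(i < n) tl (c' i) (b i) -> forall i, c i = c' i).

Definition rdim_eq (K : fieldType) (V : tsv K) (n : nat) : Prop :=
  exists b : 'I_n -> V,
    (forall v : V, exists c : 'I_n -> K,
        v = \big[@tadd K V / tzero V]_(i < n) tr (b i) (c i)) /\
    (forall c c' : 'I_n -> K,
        \big[@tadd K V / tzero V]_(i < n) tr (b i) (c i) =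
        \big[@tadd K V / tzero V]_(i < n) tr (b i) (c' i) -> forall i, c i = c' i).

Definition has_rank (K : fieldType) (V : tsv K) (n : nat) : Prop :=
  ldim_eq V n /\ rdim_eq V n.

Definition rlin (K : fieldType) (V : tsv K) (psi : V -> K) : Prop :=
  (forall u v : V, psi (tadd u v) = psi u + psi v) /\ (forall (v : V) (b : K), psi (tr v b) = psi v * b).

Definition llin (K : fieldType) (V : tsv K) (phi : V -> K) : Prop :=
  (forall u v : V, phi (tadd u v) = phi u + phi v) /\ (forall (a : K) (v : V), phi (tl a v) = a * phi v).

Section Duals.
Variables (K : fieldType) (V : tsv K) (HV : bimod_compat V).

Definition rdual_car := {psi : V -> K | rlin psi}.

Lemma rlin0 : rlin (fun _ : V => (0 : K)).
Proof. by split=> *; rewrite ?addr0 ?mul0r. Qed.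

Lemma rlinD (p q : V -> K) : rlin p -> rlin q -> rlin (fun x => p x + q x).
Proof.
move=> [pD pZ] [qD qZ]; split=> *; first by rewrite pD qD addrACA.
by rewrite pZ qZ mulrDl.
Qed.

Lemma rlinL a (p : V -> K) : rlin p -> rlin (fun x => a * p x).
Proof. by move=> [pD pZ]; split=> *; rewrite ?pD ?pZ ?mulrDr ?mulrA. Qed.

Lemma rlinR b (p : V -> K) : rlin p -> rlin (fun x => p (tl b x)).
Proof.
case: HV => lD _ lr [pD pZ]; split=> *; first by rewrite lD pD.
by rewrite lr pZ.
Qed.

(** Right dual V^* = Hom_K(V_K, K), (a.psi.b)(x) = a psi(b x). *)
Definition rdual : tsv K := @TSV K rdual_car
  (exist _ _ rlin0)
  (fun p q => exist _ _ (rlinD (proj2_sig p) (proj2_sig q)))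
  (fun a p => exist _ _ (rlinL a (proj2_sig p)))
  (fun p b => exist _ _ (rlinR b (proj2_sig p))).

Definition ldual_car := {phi : V -> K | llin phi}.

Lemma llin0 : llin (fun _ : V => (0 : K)).
Proof. by split=> *; rewrite ?addr0 ?mulr0. Qed.

Lemma llinD (p q : V -> K) : llin p -> llin q -> llin (fun x => p x + q x).
Proof.
move=> [pD pZ] [qD qZ]; split=> *; first by rewrite pD qD addrACA.
by rewrite pZ qZ mulrDr.
Qed.

Lemma llinR b (p : V -> K) : llin p -> llin (fun x => b * p x).
Proof.
move=> [pD pZ]; split=> *; first by rewrite pD mulrDr.
by rewrite pZ mulrCA.
Qed.

Lemma llinL a (p : V -> K) : llin p -> llin (fun x => p (tr x a)).
Proof.
case: HV => _ rD lr [pD pZ]; split=> *; first by rewrite rD pD.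
by rewrite -lr pZ.
Qed.

(** Left dual *V = Hom_K(_K V, K), (a.phi.b)(x) = b phi(x a). *)
Definition ldual : tsv K := @TSV K ldual_car
  (exist _ _ llin0)
  (fun p q => exist _ _ (llinD (proj2_sig p) (proj2_sig q)))
  (fun a p => exist _ _ (llinL a (proj2_sig p)))
  (fun p b => exist _ _ (llinR b (proj2_sig p))).

End Duals.

Section Vnu.
Variables (K L : fieldType) (iota nu : {rmorphism K -> L}).

Let C := in_comp iota nu.

Lemma C0 : C 0. Proof. by move=> P [] *. Qed.
Lemma Ciota a : C (iota a). Proof. by move=> P _ H _; apply: H. Qed.
Lemma Cnu a : C (nu a). Proof. by move=> P _ _ H; apply: H. Qed.
Lemma CM x y : C x -> C y -> C (x * y).
Proof. by move=> hx hy P HP H1 H2; case: (HP) => _ _ _ M _; apply: M; [apply: hx|apply: hy]. Qed.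
Lemma CD x y : C x -> C y -> C (x + y).
Proof.
move=> hx hy P HP H1 H2; have [P0 _ Sb _ _] := HP.
have -> : x + y = x - (0 - y) by rewrite sub0r opprK.
by apply: (Sb); [apply: hx | apply: (Sb) => //; apply: hy].
Qed.

Definition Vcar := {x : L | C x}.

Lemma Vcar_eq (u v : Vcar) : proj1_sig u = proj1_sig v -> u = v.
Proof. case: u v => x hx [y hy] /= e; subst y; f_equal; apply: proof_irrelevance. Qed.

(** V(nu): underlying set K(nu), a.v.b = a v nu(b). *)
Definition Vnu : tsv K := @TSV K Vcar
  (exist _ 0 C0)
  (fun u v => exist _ _ (CD (proj2_sig u) (proj2_sig v)))
  (fun a v => exist _ _ (CM (Ciota a) (proj2_sig v)))
  (fun v b => exist _ _ (CM (proj2_sig v) (Cnu b))).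

Lemma Vnu_compat : bimod_compat Vnu.
Proof.
split=> *; apply: Vcar_eq => /=; by rewrite ?mulrDr ?mulrDl ?mulrA.
Qed.

End Vnu.

(* Main.v *)
(** Write [L] for the algebraic closure, [C] for the compositum [K(lam)].
    The automorphism [lamb] of [L] maps [K(mu)] onto [K(lam)] and exchanges the
    roles of the two embeddings, so [V(mu)] is [V(lam)] with left and right
    actions swapped. As [K] is perfect, the fixed field of [Aut(L/K)] is [K], and
    Dedekind's independence of the [n] characters in the orbit of [lam] then gives
    [[C : K] = n]. Finally, for a finite extension [C/F] the space [Hom_F(C, F)]
    is free of rank one over [C], on any nonzero functional; with [F = K] and
    [F = lam(K)] this identifies both duals of [V(lam)] with the swapped
    bimodule. *)
From HB Require Import structures.
Require Import Defs.
From mathcomp Require Import all_boot all_order all_algebra.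
From mathcomp Require Import boolp classical_sets.
Import GRing.Theory.
Local Open Scope ring_scope.
Set Implicit Arguments.
Unset Strict Implicit.

(** * Polynomials with zero derivative over a perfect field *)

(** Each coefficient satisfies i p_i = 0: the leading one forces a positive characteristic [e], and
    only exponents divisible by [e] survive. After [e]-th roots of the coefficients are taken,
    Frobenius on [{poly K}] shows [p] to be an [e]-th power. *)
Lemma perfect_deriv0 (K : fieldType) (p : {poly K}) :
  perfect K -> p^`() = 0 -> (1 < size p)%N -> exists h e, (1 < e)%N /\ h ^+ e = p.
Proof.
move=> perfK dp0 sp.
have p0 : p != 0 by rewrite -size_poly_gt0 ltnW.
have dpi i : p`_i *+ i = 0.
  by case: i => [|i]; [rewrite mulr0n | rewrite -coef_deriv dp0 coef0].
have d0 : (0 < (size p).-1)%N by rewrite -ltnS (ltn_predK sp).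
have : ((size p).-1)%:R == 0 :> K.
  have := dpi (size p).-1; rewrite -lead_coefE -[_ *+ _]mulr_natr => /eqP.
  by rewrite mulf_eq0 lead_coef_eq0 (negPf p0).
case/(natf0_pchar d0) => e eK; have e1 := prime_gt1 (pcharf_prime eK).
have [r rE] := choice (perfK _ eK).
have eP : e \in [pchar {poly K}] by rewrite pchar_poly.
(* The bound [size p] is generous: once j e reaches [size p], the coefficient of [p] is 0. *)
exists (\poly_(j < size p) r p`_(j * e)), e; split=> //.
rewrite -(pFrobenius_autE eP) poly_def rmorph_sum /=.
under eq_bigr do rewrite pFrobenius_autE exprZn rE -exprM.
apply/polyP=> i; rewrite coef_sum; under eq_bigr do rewrite coefZ coefXn.
have [/dvdnP[j ->]|ei] := boolP (e %| i)%N; last first.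
  rewrite big1 => [|j _]; last first.
    by case: eqP => [iE|]; rewrite ?mulr0 //; move: ei; rewrite iE dvdn_mull.
  have /eqP := dpi i; rewrite -mulr_natr mulf_eq0 -(dvdn_pcharf eK) (negPf ei) orbF.
  by move/eqP.
have eqe (k l : nat) : (k * e == l * e)%N = (k == l) by rewrite eqn_pmul2r // ltnW.
have [jp|pj] := ltnP j (size p).
  rewrite (bigD1 (Ordinal jp)) //= eqxx mulr1 big1 ?addr0 // => l lj.
  by rewrite eqe eq_sym -(inj_eq val_inj) /= in lj *; rewrite (negPf lj) mulr0.
rewrite big1 => [|l _]; last by rewrite eqe gtn_eqF ?mulr0 // (leq_trans (ltn_ord l)).
by rewrite nth_default // (leq_trans pj) // leq_pmulr // ltnW.
Qed.

(** * Roots and endomorphisms of the algebraic closure *)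

Section GaloisAction.
Variables (K : fieldType) (L : closedFieldType) (iota : {rmorphism K -> L}).
Hypothesis iota_alg : is_algebraic_closure iota.

(** Factors ['X] can be stripped from an annihilating polynomial, since [x] is not a root of
    ['X]. *)
Lemma alg_root_coef0_neq0 (x : L) : x != 0 ->
  exists p : {poly K}, (map_poly iota p).[x] = 0 /\ p`_0 != 0.
Proof.
move=> x0; have [p []] := iota_alg x.
elim/poly_ind: p => [|p c IHp]; first by rewrite eqxx.
have [-> |c0] := eqVneq c 0; last first.
  move=> _ /rootP pc0; exists (p * 'X + c%:P); split=> //.
  by rewrite coefD coefMX coefC /= add0r.
rewrite addr0 mulf_eq0 polyX_eq0 orbF => p0.
by rewrite rmorphM /= map_polyX rootM rootX (negPf x0) orbF; apply: IHp.
Qed.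

(** A polynomial over [iota] killing [z] is the [s]-image of [map_poly mu p], which splits in [L],
    so [z] is the image of one of its roots. With [mu = iota], every endomorphism of [L] over [K] is
    an automorphism. *)
Lemma rmorph_surj_over (mu : {rmorphism K -> L}) (s : {rmorphism L -> L}) :
  (forall a, s (mu a) = iota a) -> forall z, exists x, s x = z.
Proof.
move=> smu z; have [p [p0 /rootP pz]] := iota_alg z.
have [r pr] := closed_field_poly_normal (map_poly mu p).
have ps : map_poly iota p = map_poly s (map_poly mu p).
  by apply/polyP=> i; rewrite !coef_map /= smu.
move: pz; rewrite ps pr map_polyZ rmorph_prod /= hornerZ horner_prod => /eqP.
rewrite mulf_eq0 fmorph_eq0 lead_coef_eq0 map_poly_eq0 (negPf p0) /=.
rewrite prodf_seq_eq0 => /hasP[x _ /=].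
rewrite rmorphB /= map_polyX map_polyC /= !hornerE subr_eq0 => /eqP ->.
by exists x.
Qed.

(** * Extension of partial morphisms over [K] to the whole of [L] *)

Definition iota_graph : set (L * L) := [set u | exists a, u = (iota a, iota a)].

(** Graph of a [K]-algebra morphism from a subring of [L] to [L]; as a graph is
    closed under differences, it is single-valued once [0] has the only image
    [0]. *)
Definition partial_hom (A : set (L * L)) : Prop :=
  [/\ forall a, A (iota a, iota a),
      forall u v, A u -> A v -> A (u.1 - v.1, u.2 - v.2),
      forall u v, A u -> A v -> A (u.1 * v.1, u.2 * v.2) &
      forall y, A (0, y) -> y = 0].

Lemma partial_hom_iota : partial_hom iota_graph.
Proof.
split=> [a|_ _ [a ->] [b ->]|_ _ [a ->] [b ->]|y [a [/esym/eqP]]].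
- by exists a.
- by exists (a - b); rewrite rmorphB.
- by exists (a * b); rewrite rmorphM.
- by rewrite fmorph_eq0 => /eqP -> ->; rewrite rmorph0.
Qed.

(** [q] is the image of [p] under the morphism of graph [A], applied to coefficients; indices past
    both sizes only ask for (0, 0). *)
Definition poly_graph (A : set (L * L)) (p q : {poly L}) : Prop :=
  forall i, A (p`_i, q`_i).

Section Extension.
Variable A : set (L * L).
Hypothesis homA : partial_hom A.

Lemma partial_hom0 : A (0, 0).
Proof. by have [Ai _ _ _] := homA; have := Ai 0; rewrite rmorph0. Qed.

Lemma partial_homD u v : A u -> A v -> A (u.1 + v.1, u.2 + v.2).
Proof.
have [_ AB _ _] := homA => Au Av.
have := AB _ _ Au (AB _ _ partial_hom0 Av).
by rewrite /= !sub0r !opprK.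
Qed.

Lemma partial_hom_sum (I : Type) (r : seq I) (F G : I -> L) :
  (forall i, A (F i, G i)) -> A (\sum_(i <- r) F i, \sum_(i <- r) G i).
Proof.
move=> AFG; elim: r => [|i r IHr]; first by rewrite !big_nil; apply: partial_hom0.
by rewrite !big_cons; apply: (@partial_homD (_, _) (_, _)).
Qed.

Lemma partial_homX u n : A u -> A (u.1 ^+ n, u.2 ^+ n).
Proof.
have [Ai _ AM _] := homA => Au.
elim: n => [|n IHn]; first by have := Ai 1; rewrite rmorph1.
by rewrite !exprS; apply: (AM _ _ Au IHn).
Qed.

Lemma partial_hom_horner (p : {poly K}) u : A u ->
  A ((map_poly iota p).[u.1], (map_poly iota p).[u.2]).
Proof.
have [Ai _ AM _] := homA => Au.
rewrite !horner_coef; apply: partial_hom_sum => i.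
by rewrite !coef_map /=; apply: (AM (_, _) (_, _)) => //; apply: partial_homX.
Qed.

(* If [x != 0] is sent to [0], take [p] over [K] with [p(x) = 0] and [p(0) != 0]:
   the morphism sends [p(x)] to [p(0)]. *)
Lemma partial_hom_inj x : A (x, 0) -> x = 0.
Proof.
have [_ _ _ A0] := homA => Ax; apply/eqP/negPn/negP=> x0.
have [p [px p0]] := alg_root_coef0_neq0 x0.
have := partial_hom_horner p Ax; rewrite /= px => /A0 /eqP.
by rewrite horner_coef0 coef_map fmorph_eq0 (negPf p0).
Qed.

Lemma partial_hom_eq0 x y : A (x, y) -> (x == 0) = (y == 0).
Proof.
have [_ _ _ A0] := homA => Axy.
by apply/eqP/eqP => e; move: Axy; rewrite e; [apply: A0 | apply: partial_hom_inj].
Qed.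

Lemma partial_hom_fun x y y' : A (x, y) -> A (x, y') -> y = y'.
Proof.
have [_ AB _ A0] := homA => Axy Axy'; apply/eqP; rewrite -subr_eq0; apply/eqP.
by apply: A0; have := AB _ _ Axy Axy'; rewrite /= subrr.
Qed.

(** The morphism is injective, so corresponding coefficients vanish together. *)
Lemma poly_graph_size p q : poly_graph A p q -> size p = size q.
Proof.
move=> Apq; apply/eqP; rewrite eqn_leq; apply/andP; split.
  apply/leq_sizeP=> i iq; apply/eqP; rewrite (partial_hom_eq0 (Apq i)).
  by rewrite nth_default.
apply/leq_sizeP=> i iq; apply/eqP; rewrite -(partial_hom_eq0 (Apq i)).
by rewrite nth_default.
Qed.

Lemma poly_graphC x y : A (x, y) -> poly_graph A x%:P y%:P.
Proof. by move=> Axy i; rewrite !coefC; case: ifP => // _; apply: partial_hom0. Qed.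

Lemma poly_graphB p q p' q' : poly_graph A p q -> poly_graph A p' q' ->
  poly_graph A (p - p') (q - q').
Proof.
have [_ AB _ _] := homA => Apq Apq' i.
by rewrite !coefB; apply: (AB (_, _) (_, _)).
Qed.

Lemma poly_graphM p q p' q' : poly_graph A p q -> poly_graph A p' q' ->
  poly_graph A (p * p') (q * q').
Proof.
have [_ _ AM _] := homA => Apq Apq' i.
by rewrite !coefM; apply: partial_hom_sum => j; apply: (AM (_, _) (_, _)).
Qed.

Lemma poly_graphX : poly_graph A 'X 'X.
Proof.
have [Ai _ _ _] := homA => i; rewrite !coefX.
by have := Ai (i == 1%N)%:R; rewrite rmorph_nat.
Qed.

Lemma poly_graphXn n : poly_graph A 'X^n 'X^n.
Proof.
have [Ai _ _ _] := homA => i; rewrite !coefXn.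
by have := Ai (i == n)%:R; rewrite rmorph_nat.
Qed.

(** Candidate graph for extending the morphism to polynomials in [z], with [z] sent to [w]. As a
    relation, it can be formed before it is known to be single-valued. *)
Definition adjoin_graph (z w : L) : set (L * L) :=
  [set u | exists p q, poly_graph A p q /\ u = (p.[z], q.[w])].

(** [m] plays the minimal polynomial of [z] over the domain of [A], and [m'] is its image. The
    domain is given only as a ring, so [m] is not normalised to be monic. *)
Definition min_annihilator (z : L) (m m' : {poly L}) : Prop :=
  [/\ poly_graph A m m', m != 0, m.[z] = 0 &
      forall p q, poly_graph A p q -> p.[z] = 0 -> p != 0 -> (size m <= size p)%N].

Lemma min_annihilatorP z : exists m m', min_annihilator z m m'.
Proof.
pose P n := `[< exists p q, [/\ poly_graph A p q, p != 0, p.[z] = 0 & size p = n] >].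
have exP : exists n, P n.
  have [p [p0 /rootP pz]] := iota_alg z.
  exists (size (map_poly iota p)); apply/asboolP.
  exists (map_poly iota p), (map_poly iota p); split=> //; last by rewrite map_poly_eq0.
  by have [Ai _ _ _] := homA => i; rewrite !coef_map; apply: Ai.
case: (ex_minnP exP) => n /asboolP[m [m' [Am m0 mz sm]]] minP.
exists m, m'; split=> // p q Apq pz p0; rewrite sm; apply: minP.
by apply/asboolP; exists p, q.
Qed.

(** This is what makes [adjoin_graph] single-valued. One step of pseudo-division of [p] by [m] gives
    a shorter polynomial vanishing at [z]; by induction its image vanishes at [w], and that value is
    the leading coefficient of [m'] times q(w). *)
Lemma annihilator_transfer z w m m' p q :
  min_annihilator z m m' -> m'.[w] = 0 -> poly_graph A p q -> p.[z] = 0 -> q.[w] = 0.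
Proof.
case=> Am m0 mz minm mw.
have m'0 : m' != 0 by rewrite -size_poly_eq0 -(poly_graph_size Am) size_poly_eq0.
have [n] := ubnP (size p); elim: n => // n IHn in p q * => spn Apq pz.
have [p0|p0] := eqVneq p 0.
  have : size q = 0%N by rewrite -(poly_graph_size Apq) p0 size_poly0.
  by move/eqP; rewrite size_poly_eq0 => /eqP ->; rewrite horner0.
have smp := minm _ _ Apq pz p0.
pose red (f g : {poly L}) := (lead_coef g)%:P * f - (lead_coef f)%:P * 'X^(size f - size g) * g.
have Ared : poly_graph A (red p m) (red q m').
  rewrite /red -(poly_graph_size Apq) -(poly_graph_size Am).
  have Ale f g : poly_graph A f g -> poly_graph A (lead_coef f)%:P (lead_coef g)%:P.
    by move=> Afg; apply: poly_graphC; rewrite /lead_coef -(poly_graph_size Afg).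
  apply: poly_graphB; apply: poly_graphM => //; first exact: Ale.
  by apply: poly_graphM; [apply: Ale | apply: poly_graphXn].
have sred : (size (red p m) < size p)%N.
  have sp0 : (0 < size p)%N by rewrite size_poly_gt0.
  have sm0 : (0 < size m)%N by rewrite size_poly_gt0.
  (* At index [(size p).-1] the two leading terms cancel; above it both terms vanish. *)
  rewrite -(prednK sp0) ltnS; apply/leq_sizeP=> i; rewrite leq_eqVlt => /orP[/eqP <-|ip].
    rewrite /red coefB -mulrA !coefCM coefXnM ltnNge.
    have ip : (size p - size m <= (size p).-1)%N.
      by rewrite -(prednK sm0) subnS -!subn1 leq_sub2r // leq_subr.
    rewrite ip /=.
    have -> : ((size p).-1 - (size p - size m) = (size m).-1)%N.
      by rewrite -!subn1 subnAC subKn.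
    by rewrite -!lead_coefE mulrC subrr.
  rewrite prednK // in ip.
  rewrite /red coefB -mulrA !coefCM coefXnM (nth_default _ ip) mulr0 sub0r.
  case: ifP => _; first by rewrite mulr0 oppr0.
  rewrite [m`_ _]nth_default ?mulr0 ?oppr0 //.
  by rewrite leq_subRL ?(leq_trans (leq_subr _ _) ip) // subnK.
have redz : (red p m).[z] = 0 by rewrite /red !hornerE pz mz !mulr0 subrr.
have := IHn _ _ (leq_trans sred spn) Ared redz.
rewrite /red !hornerE mw mulr0 subr0 => /eqP; rewrite mulf_eq0 lead_coef_eq0.
by rewrite (negPf m'0) => /eqP.
Qed.

Lemma partial_hom_adjoin z w m m' : min_annihilator z m m' -> m'.[w] = 0 ->
  [/\ partial_hom (adjoin_graph z w), (A `<=` adjoin_graph z w)%classic &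
      adjoin_graph z w (z, w)].
Proof.
move=> minm mw; have [Ai AB AM A0] := homA.
have Asub : (A `<=` adjoin_graph z w)%classic.
  move=> [x y] Axy; exists x%:P, y%:P; rewrite !hornerC; split=> //.
  exact: poly_graphC.
split=> //; last by exists 'X, 'X; rewrite !hornerX; split=> //; apply: poly_graphX.
split=> [a|_ _ [p [q [Apq ->]]] [p' [q' [Apq' ->]]]
          |_ _ [p [q [Apq ->]]] [p' [q' [Apq' ->]]]|y [p [q [Apq [pz ->]]]]].
- exact: Asub.
- by exists (p - p'), (q - q'); rewrite !hornerE; split=> //; apply: poly_graphB.
- by exists (p * p'), (q * q'); rewrite !hornerM; split=> //; apply: poly_graphM.
- exact: annihilator_transfer minm mw Apq (esym pz).
Qed.

End Extension.

Lemma maximal_partial_hom (A0 : set (L * L)) : partial_hom A0 ->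
  exists A, [/\ partial_hom A, (A0 `<=` A)%classic &
    forall B, partial_hom B -> (A `<=` B)%classic -> (B `<=` A)%classic].
Proof.
move=> homA0.
(* The condition bears on the union of [X] with [A0], so that it also holds for the union of the
   empty chain. *)
have [|A [homA maxA]] := @Zorn_bigcup (L * L) (fun X => partial_hom (X `|` A0)%classic).
  move=> F homF totF; set U := (_ `|` _)%classic.
  have [Ai0 AB0 AM0 A00] := homA0.
  (* Each closure property involves at most two points, and in a chain these lie in a common partial
     morphism. *)
  have F2 u v : U u -> U v -> exists2 B, partial_hom B & [/\ B u, B v & (B `<=` U)%classic].
    have FU X : F X -> (X `|` A0 `<=` U)%classic.
      by move=> FX x [Xx|]; [left; exists X | right].
    case=> [[X FX Xu]|A0u] [[Y FY Yv]|A0v].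
    - have [XY|YX] := totF _ _ FX FY.
        exists (Y `|` A0)%classic; first exact: homF.
        by split; [left; apply: XY | left | apply: FU].
      exists (X `|` A0)%classic; first exact: homF.
      by split; [left | left; apply: YX | apply: FU].
    - by exists (X `|` A0)%classic; [apply: homF | split; [left | right | apply: FU]].
    - by exists (Y `|` A0)%classic; [apply: homF | split; [right | left | apply: FU]].
    - by exists A0 => //; split=> // x; right.
  split=> [a|u v Uu Uv|u v Uu Uv|y Uy]; first by right.
  - by have [B [_ BB _ _] [Bu Bv]] := F2 _ _ Uu Uv; apply; apply: BB.
  - by have [B [_ _ BM _] [Bu Bv]] := F2 _ _ Uu Uv; apply; apply: BM.
  - by have [B [_ _ _ B0] [Bu _ _]] := F2 _ _ Uy Uy; apply: B0.
exists (A `|` A0)%classic; split=> // B homB AB x Bx.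
apply: contrapT => nAx; apply: (maxA B); last first.
  suff -> : (B `|` A0 = B)%classic by [].
  by apply/seteqP; split=> [y [//|A0y]|y]; [apply: AB; right | left].
by split=> [y Ay|BA]; [apply: AB; left | apply: nAx; left; apply: BA].
Qed.

(** A maximal extension is defined everywhere: the image of a minimal annihilator of [z] has a root
    [w] in [L], and adjoining (z, w) must stay inside the maximal graph. *)
Lemma partial_hom_extend (A0 : set (L * L)) : partial_hom A0 ->
  exists s : {rmorphism L -> L},
    (forall a, s (iota a) = iota a) /\ forall u, A0 u -> s u.1 = u.2.
Proof.
move=> /maximal_partial_hom[A [homA A0A maxA]]; have [Ai AB AM _] := homA.
have totA z : exists w, A (z, w).
  have [m [m' minm]] := min_annihilatorP homA z.
  have [Am m0 mz _] := minm.
  (* [m'] has the size of [m], which is nonzero with a root and hence not constant. *)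
  have /closed_rootP[w /rootP mw] : size m' != 1%N.
    rewrite -(poly_graph_size homA Am); apply/negP=> /size_poly1P[c c0 mc].
    by move: mz; rewrite mc hornerC => /eqP; rewrite (negPf c0).
  have [homB sAB Bzw] := partial_hom_adjoin homA minm mw.
  by exists w; apply: maxA Bzw.
have [s sA] := choice totA.
have sE x y : A (x, y) -> s x = y by apply: partial_hom_fun.
have sB : zmod_morphism s.
  by move=> x y; apply: sE; apply: (AB (_, _) (_, _)).
have sM : monoid_morphism s.
  split; first by apply: sE; have := Ai 1; rewrite rmorph1.
  by move=> x y; apply: sE; apply: (AM (_, _) (_, _)).
pose sZ := GRing.isZmodMorphism.Build L L s sB.
pose sR := GRing.isMonoidMorphism.Build L L s sM.
pose sH : {rmorphism L -> L} := HB.pack s sZ sR.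
exists sH; split=> [a|[x y] /A0A]; first exact: sE.
exact: sE.
Qed.

(** * Separability and the fixed field of the automorphisms over [K] *)

(** Write the minimal polynomial as m = q (X - x). Separability gives q(x) = m'(x) != 0, and [q] is
    not constant because [x] is not in [K]; any root of [q] is then a conjugate other than [x]. *)
Lemma conjugate_neq (x : L) : perfect K -> ~ (exists a, x = iota a) ->
  exists2 m, min_annihilator iota_graph x m m & exists2 y, y != x & m.[y] = 0.
Proof.
move=> perfK xK.
have [m [m' minm]] := min_annihilatorP partial_hom_iota x.
have [Am m0 mx min_m] := minm.
(* Over [iota_graph] the coefficients come from [K], and [m'] coincides with [m]. *)
have [c cE] := choice Am.
pose m1 : {poly K} := \poly_(i < size m) c i.
have mE : m = map_poly iota m1.
  apply/polyP=> i; rewrite coef_map coef_poly /=.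
  by case: ltnP => im; [case: (cE i) | rewrite nth_default ?rmorph0].
have m'E : m' = m.
  by apply/polyP=> i; case: (cE i) => -> ->.
rewrite m'E in minm; exists m => //.
have sm1 : size m1 = size m by rewrite mE size_map_poly.
have min_m1 (p : {poly K}) : (map_poly iota p).[x] = 0 -> p != 0 -> (size m <= size p)%N.
  move=> px p0; rewrite -(size_map_poly iota); apply: (min_m _ (map_poly iota p)) => //.
    by move=> i; rewrite coef_map; exists p`_i.
  by rewrite map_poly_eq0.
have m10 : m1 != 0 by rewrite -size_poly_gt0 sm1 size_poly_gt0.
have sm_gt1 : (1 < size m)%N.
  rewrite ltnNge; apply/negP=> /size1_polyC mC.
  by move: mx m0; rewrite mC hornerC => ->; rewrite eqxx.
(* If the derivative vanished at [x], minimality would make it zero; then [m1] is a proper power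
   h^e, and [h] is a shorter annihilator. *)
have dm1x : (map_poly iota m1^`()).[x] != 0.
  apply/eqP=> dx; have [d0|d0] := eqVneq m1^`() 0; last first.
    by have := min_m1 _ dx d0; rewrite -sm1 leqNgt lt_size_deriv.
  have [|h [e [e1 he]]] := perfect_deriv0 perfK d0; first by rewrite sm1.
  have h0 : h != 0 by apply: contra_neq m10 => h0; rewrite -he h0 expr0n gtn_eqF // ltnW.
  have hx : (map_poly iota h).[x] = 0.
    have : (map_poly iota m1).[x] = 0 by rewrite -mE.
    by rewrite -he rmorphXn /= horner_exp => /eqP; rewrite expf_eq0 => /andP[_ /eqP].
  have := min_m1 _ hx h0; rewrite -sm1 -he leqNgt => /negP; apply.
  have h_gt1 : (0 < (size h).-1)%N.
    rewrite lt0n; apply/negP=> /eqP sh; move: sm_gt1.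
    have := size_exp h e; rewrite he sm1 sh mul0n => sme.
    by case: (size m) sme => [|[]].
  have := size_exp h e; rewrite he => sme.
  rewrite -(prednK (_ : 0 < size h)%N) ?size_poly_gt0 //.
  by rewrite -(prednK (_ : 0 < size m1)%N) ?size_poly_gt0 // ltnS sme ltn_Pmulr.
have /factor_theorem[q qE] : root m x by apply/rootP.
have qx : q.[x] != 0.
  move: dm1x; rewrite -deriv_map -mE qE derivM derivXsubC mulr1 !hornerE.
  by rewrite subrr mulr0 add0r.
have /closed_rootP[y /rootP qy] : size q != 1%N.
  (* If [q] is a constant c0, then m = c0 X - c0 x, and [x] is a quotient of coefficients of [m]. *)
  apply/negP=> /size_poly1P[c0 c00 qC]; apply: xK.
  have c0E : exists a, c0 = iota a.
    have [a [ma _]] := Am 1%N; exists a; rewrite -ma qE qC mulrBr coefB -polyCM.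
    by rewrite coefC coefMX coefC /= subr0.
  have [a ca] := c0E; have [b [mb _]] := Am 0%N.
  exists (- b / a); rewrite rmorphM fmorphV rmorphN /= -ca -mb qE qC mulrBr coefB.
  by rewrite -polyCM coefC coefMX /= sub0r opprK mulrC mulKf.
exists y; first by apply: contraNneq qx => <-; rewrite qy.
by rewrite qE hornerM qy mul0r.
Qed.

(** Otherwise [x] could be sent to another conjugate [y]; this extends to an endomorphism of [L]
    over [K], which is bijective. *)
Lemma gal_fixed (x : L) : perfect K ->
  (forall s, in_Gal iota s -> s x = x) -> exists a, x = iota a.
Proof.
move=> perfK sx; apply: contrapT => xK.
have [m minm [y yx my]] := conjugate_neq perfK xK.
have [homB _ Bxy] := partial_hom_adjoin partial_hom_iota minm my.
have [s [si sB]] := partial_hom_extend homB.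
have /= sxy := sB _ Bxy; case/eqP: yx; rewrite -sxy; apply: sx; split=> //.
have [t tK] := choice (rmorph_surj_over si).
by exists t => // z; apply: (fmorph_inj s); rewrite tK.
Qed.

End GaloisAction.

(** * Linear independence of characters *)

(** Induction on the number of nonzero coefficients. If c_i0 != 0 and f_j(b) != f_i0(b), the
    coefficients c_i (f_i(b) - f_i0(b)) form a relation without the index [i0], which forces c_j =
    0. Only c_i0 is left, and evaluation at 1 kills it. *)
Lemma dedekind_independence (K L : fieldType) n (f : 'I_n -> K -> L) :
  (forall i a b, f i (a * b) = f i a * f i b) -> (forall i, f i 1 = 1) ->
  (forall i j, (forall a, f i a = f j a) -> i = j) ->
  forall c : 'I_n -> L, (forall a, \sum_i c i * f i a = 0) -> forall i, c i = 0.
Proof.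
move=> fM f1 finj c; have [m] := ubnP #|[pred i | c i != 0]|.
elim: m => // m IHm in c * => cm cf i0; apply/eqP/negPn/negP=> ci0.
have c0 j : j != i0 -> c j = 0.
  move=> ji0; have [b fb] : exists b, f j b != f i0 b.
    apply: contrapT => nb; case/eqP: ji0; apply: finj => a.
    by apply/eqP/negPn/negP=> fa; apply: nb; exists a.
  have /eqP : c j * (f j b - f i0 b) = 0.
    apply: (IHm (fun i => c i * (f i b - f i0 b))) => [|a].
      rewrite (leq_trans _ (cm : _ <= m)%N) //; apply: proper_card.
      apply/properP; split; last by exists i0; rewrite !inE ?subrr ?mulr0 ?eqxx.
      by apply/fintype.subsetP=> i; rewrite !inE mulf_eq0 negb_or => /andP[].
    transitivity (\sum_i c i * f i (b * a) - f i0 b * \sum_i c i * f i a).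
      rewrite mulr_sumr -sumrB; apply: eq_bigr => i _.
      by rewrite fM mulrBr mulrBl mulrA [f i0 b * _]mulrCA mulrA.
    by rewrite !cf mulr0 subrr.
  by rewrite mulf_eq0 subr_eq0 (negPf fb) orbF => /eqP.
have := cf 1; rewrite (bigD1 i0) //= big1 => [|j /c0 ->]; last by rewrite mul0r.
by rewrite f1 mulr1 addr0 => /eqP; rewrite (negPf ci0).
Qed.

(** The vectors (f_i(x))_i span L^n by independence, so [n] independent ones can be chosen
    greedily. *)
Lemma dedekind_unitmx (K L : fieldType) n (f : 'I_n -> K -> L) :
  (forall i a b, f i (a * b) = f i a * f i b) -> (forall i, f i 1 = 1) ->
  (forall i j, (forall a, f i a = f j a) -> i = j) ->
  exists a : 'I_n -> K, \matrix_(i, j) f i (a j) \in unitmx.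
Proof.
move=> fM f1 finj.
suff H m : (m <= n)%N -> exists a : 'I_m -> K, row_free (\matrix_(j < m, i < n) f i (a j)).
  have [a] := H n (leqnn n); rewrite row_free_unit -unitmx_tr => aU; exists a.
  by congr (_ \in unitmx): aU; apply/matrixP=> i j; rewrite !mxE.
elim: m => [_|m IHm mn].
  by exists (fun=> 0); rewrite /row_free -leqn0 rank_leq_row.
have [a] := IHm (ltnW mn); set A := (\matrix_(_, _) _) => freeA.
pose v x : 'rV[L]_n := \row_i f i x.
have [x vA] : exists x, ~~ (v x <= A)%MS.
  apply: contrapT => nx.
  (* If every vector lay in the row space of [A], each column of the cokernel would be a linear
     relation among the characters; yet the cokernel has rank n - m > 0. *)
  have : cokermx A = 0.
    apply/matrixP=> i j; rewrite [RHS]mxE.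
    apply: (dedekind_independence fM f1 finj (c := fun i => cokermx A i j)) => x.
    have : (v x <= A)%MS by apply/negPn/negP=> vA; apply: nx; exists x.
    rewrite submxE => /eqP/matrixP/(_ ord0 j); rewrite !mxE => vA.
    by rewrite -[RHS]vA; apply: eq_bigr => l _; rewrite /v [X in _ = X * _]mxE mulrC.
  move/(congr1 mxrank); rewrite mxrank0 mxrank_coker (eqP freeA) => /eqP.
  by rewrite subn_eq0 leqNgt mn.
rewrite -addn1; exists (fun j => match split j with inl j => a j | inr _ => x end).
set B := (\matrix_(_, _) _).
have -> : B = col_mx A (v x).
  by apply/matrixP=> i j; rewrite !mxE; case: split => k; rewrite mxE.
have rkA : (\rank A < \rank (A + v x)%MS)%N.
  by apply: rank_ltmx; rewrite ltmxE addsmxSl addsmx_sub submx_refl.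
rewrite /row_free eqn_leq rank_leq_row -addsmxE; apply: leq_trans rkA.
by rewrite (eqP freeA) addn1.
Qed.

(** * A basis of the compositum over [K] from the orbit *)

(** Scalars stay in [K] and act through [rho], so one notion serves the left action ([rho = iota])
    and the right action ([rho = nu]). *)
Definition basis_over (K L : fieldType) (rho : K -> L) (E : L -> Prop) n
    (b : 'I_n -> L) : Prop :=
  [/\ forall i, E (b i),
      forall x, E x -> exists c : 'I_n -> K, x = \sum_i rho (c i) * b i &
      forall c : 'I_n -> K, \sum_i rho (c i) * b i = 0 -> forall i, c i = 0].

Section Orbit.
Variables (K : fieldType) (L : closedFieldType) (iota : {rmorphism K -> L}).
Hypotheses (iota_alg : is_algebraic_closure iota) (perfK : perfect K).
Variable lam : {rmorphism K -> L}.

(** Let [f i] be the points of the orbit and [a] be such that the matrix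
    [f i (a j)] is invertible. The linear system expressing the [f i x] in terms
    of the [f i (a j)] has a unique solution; an automorphism over [K] permutes
    its equations, hence fixes the solution, which therefore lies in [K]. *)
Lemma orbit_basis n : orbit_card iota lam n ->
  exists b : 'I_n -> L, basis_over iota (in_comp iota lam) b.
Proof.
case=> f [f_orb [orb_f f_inj]].
have fM i a b : f i (a * b) = f i a * f i b.
  by have [s [_ fE]] := f_orb i; rewrite !fE !rmorphM.
have f1 i : f i 1 = 1 by have [s [_ fE]] := f_orb i; rewrite !fE !rmorph1.
have [a aU] := dedekind_unitmx fM f1 f_inj; set M := (\matrix_(_, _) _) in aU.
have [i0 lamE] : exists i, forall x, lam x = f i x.
  apply: orb_f; exists idfun; split=> //; split=> //.
  by exists idfun.
have coef x : exists c : 'I_n -> K, forall i, f i x = \sum_j iota (c j) * f i (a j).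
  pose col_f y : 'cV[L]_n := \col_i f i y.
  pose c := invmx M *m col_f x.
  have McP (d : 'cV[L]_n) : (forall i, f i x = \sum_j d j 0 * f i (a j)) <-> M *m d = col_f x.
    split=> [fd|Md i]; last first.
      have := congr1 (fun N : 'cV_n => N i 0) Md; rewrite !mxE => <-.
      by apply: eq_bigr => j _; rewrite mxE mulrC.
    by apply/matrixP=> i j; rewrite !mxE fd; apply: eq_bigr => l _; rewrite (ord1 j) mxE mulrC.
  have cE := (McP c).2 (mulKVmx aU _).
  have c_fix j : exists y, c j 0 = iota y.
    apply: (gal_fixed iota_alg perfK) => s galS.
    have [[s' sK s'K] si] := galS.
    have [g gE] : {g : 'I_n -> 'I_n & forall i y, s (f i y) = f (g i) y}.
      apply: (@choice _ _ (fun i i' => forall y, s (f i y) = f i' y)) => i.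
      apply: (orb_f (fun y => s (f i y))).
      have [t [[[t' tK t'K] ti] tE]] := f_orb i.
      exists (s \o t); split; last by move=> y /=; rewrite tE.
      split; last by move=> y /=; rewrite ti si.
      by exists (t' \o s'); [apply: can_comp | apply: can_comp].
    have g_inj : injective g.
      move=> i i' eq_g; apply: f_inj => y; apply: (fmorph_inj s).
      by rewrite !gE eq_g.
    have scE : map_mx s c = c.
      apply: (can_inj (mulKmx aU)); rewrite [RHS](mulKVmx aU); apply/McP => i.
      have /codomP[i' ->] := injF_onto g_inj i.
      rewrite -gE cE rmorph_sum; apply: eq_bigr => l _.
      by rewrite rmorphM gE [X in _ = X * _]mxE.
    by move/matrixP/(_ j 0): scE; rewrite [X in X = _ -> _]mxE.
  have [d dE] := choice c_fix; exists d => i.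
  by rewrite cE; apply: eq_bigr => j _; rewrite dE.
(* The span [W] contains all of [lam K], hence products of its generators. It is shown to be a
   subfield, and so contains the compositum. *)
pose W x := exists c : 'I_n -> K, x = \sum_j iota (c j) * lam (a j).
have W0 : W 0.
  by exists (fun=> 0); rewrite big1 // => j _; rewrite rmorph0 mul0r.
have WD x y : W x -> W y -> W (x + y).
  move=> [c ->] [d ->]; exists (fun j => c j + d j).
  by rewrite -big_split; apply: eq_bigr => j _; rewrite rmorphD mulrDl.
have WZ t x : W x -> W (iota t * x).
  move=> [c ->]; exists (fun j => t * c j).
  by rewrite mulr_sumr; apply: eq_bigr => j _; rewrite rmorphM mulrA.
have Wsum m (F : 'I_m -> L) : (forall i, W (F i)) -> W (\sum_i F i).
  by move=> WF; apply: (big_ind W) => // i _; apply: WF.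
have Wlam x : W (lam x).
  have [c cE] := coef x; exists c; rewrite lamE cE.
  by apply: eq_bigr => j _; rewrite lamE.
have WM x y : W x -> W y -> W (x * y).
  move=> [c ->] [d ->]; rewrite mulr_suml; apply: (Wsum) => i.
  rewrite mulr_sumr; apply: Wsum => j.
  by rewrite mulrACA -rmorphM -rmorphM; apply: WZ.
have W1 : W 1 by rewrite -(rmorph1 lam).
have Wi t : W (iota t) by rewrite -[iota t]mulr1; apply: WZ.
have Wfield : subfield_closed W.
  split=> // [x y Wx Wy|x Wx].
    by rewrite -mulN1r -(rmorph1 iota) -rmorphN; apply: WD => //; apply: WZ.
  have [->|x0] := eqVneq x 0; first by rewrite invr0.
  (* From q(x) x + t = 0 with [t] nonzero, the inverse of [x] is -q(x)/t, a polynomial in [x]. *)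
  have [p [px]] := alg_root_coef0_neq0 iota_alg x0.
  elim/poly_ind: p px => [|q t _]; first by rewrite coef0 eqxx.
  rewrite rmorphD rmorphM /= map_polyX map_polyC !hornerE coefD coefMX coefC /= add0r.
  move=> /eqP; rewrite addr_eq0 => /eqP qx t0.
  have -> : x^-1 = iota (- t^-1) * (map_poly iota q).[x].
    apply: (mulIf x0); rewrite mulVf // -mulrA qx rmorphN mulrNN -rmorphM mulVf //.
    by rewrite rmorph1.
  apply: (WZ); rewrite horner_coef; apply: Wsum => i; rewrite coef_map; apply: WZ.
  by elim: (i : nat) => [|k IHk]; rewrite ?expr0 // exprS; apply: WM.
exists (fun j => lam (a j)); split=> [j|x Cx|c lamc j].
- exact: Cnu.
- exact: (Cx W Wfield Wi Wlam).
(* The automorphisms carrying [lam] to each [f i] turn the single relation into all rows of a system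
   with matrix [M]. *)
have fc i : \sum_j iota (c j) * f i (a j) = 0.
  have [s [[_ si] fE]] := f_orb i.
  have := congr1 s lamc; rewrite rmorph0 rmorph_sum => slamc; rewrite -[RHS]slamc.
  by apply: eq_bigr => l _; rewrite rmorphM /= si fE.
have : M *m (\col_l iota (c l)) = 0.
  apply/matrixP=> i l; rewrite !mxE -[RHS](fc i); apply: eq_bigr => l' _.
  by rewrite !mxE mulrC.
move/(congr1 (mulmx (invmx M))); rewrite mulKmx // mulmx0 => /matrixP/(_ j 0).
by rewrite !mxE => /eqP; rewrite fmorph_eq0 => /eqP.
Qed.

End Orbit.

(** * Left and right dimensions of V(nu) as degrees of field extensions *)

Section Dimensions.
Variables (K L : fieldType) (iota nu : {rmorphism K -> L}).

(** Since [nu] is injective, coefficients may be read in [K] instead of in its image. *)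
Lemma ext_degreeP (E : L -> Prop) n :
  ext_degree (in_image nu) E n <-> exists b : 'I_n -> L, basis_over nu E b.
Proof.
split=> [[b [Eb [spanb freeb]]]|[b [Eb spanb freeb]]]; exists b; split=> //.
- move=> x /spanb[c [cF ->]]; have [d dE] := choice cF; exists d.
  by apply: eq_bigr => i _; rewrite dE.
- move=> c c0 i; apply/eqP; rewrite -(fmorph_eq0 nu); apply/eqP.
  by apply: (freeb (fun i => nu (c i))) => // j; exists (c j).
- split=> [x /spanb[c ->]|c cF].
    by exists (fun i => nu (c i)); split=> // i; exists (c i).
  have [d dE] := choice cF => c0 i; rewrite dE freeb ?rmorph0 // -[RHS]c0.
  by apply: eq_bigr => j _; rewrite dE.
Qed.

Lemma val_Vnu_sum n (F : 'I_n -> Vnu iota nu) :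
  proj1_sig (\big[@tadd _ _ / tzero (Vnu iota nu)]_(i < n) F i) =
  \sum_i proj1_sig (F i).
Proof. exact: big_morph. Qed.

Lemma basis_over_inj (rho : {rmorphism K -> L}) E n (b : 'I_n -> L) :
  basis_over rho E b -> forall c d : 'I_n -> K,
  \sum_i rho (c i) * b i = \sum_i rho (d i) * b i -> forall i, c i = d i.
Proof.
case=> _ _ freeb c d cd i; apply/eqP; rewrite -subr_eq0; apply/eqP.
apply: (freeb (fun i => c i - d i)); transitivity
  (\sum_i rho (c i) * b i - \sum_i rho (d i) * b i); last by rewrite cd subrr.
by rewrite -sumrB; apply: eq_bigr => j _; rewrite rmorphB mulrBl.
Qed.

Lemma ldim_VnuP n :
  ldim_eq (Vnu iota nu) n <-> exists b : 'I_n -> L, basis_over iota (in_comp iota nu) b.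
Proof.
split=> [[b [spanb freeb]]|[b bB]].
  exists (fun i => proj1_sig (b i)); split=> [i|x Cx|c c0]; first exact: (proj2_sig (b i)).
    by have [c /(congr1 (@proj1_sig _ _))] := spanb (exist _ x Cx);
      rewrite val_Vnu_sum; exists c.
  apply: (freeb c (fun=> 0)); apply: Vcar_eq; rewrite !val_Vnu_sum /= c0.
  by rewrite big1 // => i _; rewrite rmorph0 mul0r.
have [Cb spanb _] := bB; exists (fun i => exist _ (b i) (Cb i)); split=> [[x Cx]|c d].
  by have [c xE] := spanb x Cx; exists c; apply: Vcar_eq; rewrite val_Vnu_sum.
move/(congr1 (@proj1_sig _ _)); rewrite !val_Vnu_sum /=.
exact: basis_over_inj bB c d.
Qed.

Lemma rdim_VnuP n :
  rdim_eq (Vnu iota nu) n <-> exists b : 'I_n -> L, basis_over nu (in_comp iota nu) b.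
Proof.
have mulC (c : 'I_n -> K) (b : 'I_n -> L) :
    \sum_i b i * nu (c i) = \sum_i nu (c i) * b i.
  by apply: eq_bigr => i _; rewrite mulrC.
split=> [[b [spanb freeb]]|[b bB]].
  exists (fun i => proj1_sig (b i)); split=> [i|x Cx|c c0]; first exact: (proj2_sig (b i)).
    by have [c /(congr1 (@proj1_sig _ _))] := spanb (exist _ x Cx);
      rewrite val_Vnu_sum /= mulC; exists c.
  apply: (freeb c (fun=> 0)); apply: Vcar_eq; rewrite !val_Vnu_sum /= !mulC c0.
  by rewrite big1 // => i _; rewrite rmorph0 mul0r.
have [Cb spanb _] := bB; exists (fun i => exist _ (b i) (Cb i)); split=> [[x Cx]|c d].
  by have [c xE] := spanb x Cx; exists c; apply: Vcar_eq; rewrite val_Vnu_sum /= mulC.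
move/(congr1 (@proj1_sig _ _)); rewrite !val_Vnu_sum /= !mulC.
exact: basis_over_inj bB c d.
Qed.

End Dimensions.

(** * Isomorphisms of two-sided vector spaces *)

Section Isomorphisms.
Variable K : fieldType.

Lemma bij_tsv_iso (V W : tsv K) (g : W -> V) :
  injective g -> (forall v, exists w, g w = v) ->
  (forall u v, g (tadd u v) = tadd (g u) (g v)) ->
  (forall a v, g (tl a v) = tl a (g v)) ->
  (forall v b, g (tr v b) = tr (g v) b) -> tsv_iso V W.
Proof.
move=> g_inj g_surj gD gl gr; have [f fK] := choice g_surj.
exists f, g; split=> // [w|u v|a v|v b]; apply: g_inj.
- by rewrite fK.
- by rewrite gD !fK.
- by rewrite gl !fK.
- by rewrite gr !fK.
Qed.

Lemma tsv_iso_sym (V W : tsv K) : tsv_iso V W -> tsv_iso W V.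
Proof.
case=> f [g [fK gK fD fl fr]]; apply: (@bij_tsv_iso _ _ f) => //.
  exact: can_inj fK.
by move=> w; exists (g w).
Qed.

Lemma tsv_iso_trans (V W U : tsv K) : tsv_iso V W -> tsv_iso W U -> tsv_iso V U.
Proof.
case=> f [g [fK gK fD fl fr]] [f' [g' [fK' gK' fD' fl' fr']]].
exists (f' \o f), (g \o g'); split=> [||u v|a v|v b] /=.
- exact: can_comp.
- exact: can_comp.
- by rewrite fD fD'.
- by rewrite fl fl'.
- by rewrite fr fr'.
Qed.

End Isomorphisms.

(** * Linear functionals on a finite extension *)

Section Functionals.
Variables (K L : fieldType) (iota nu : {rmorphism K -> L}).
Let C := in_comp iota nu.
Let V := Vnu iota nu.

Lemma in_compV x : C x -> C x^-1.
Proof.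
by move=> Cx P P_field Pi Pnu; have [_ _ _ _ PV] := P_field; apply: (PV); apply: Cx.
Qed.

Definition Vmul (u v : V) : V := exist _ _ (CM (proj2_sig u) (proj2_sig v)).

Variable rho : {rmorphism K -> L}.
Hypothesis Crho : forall a, C (rho a).

(** Homogeneity is stated on underlying elements of [L], so that it covers left linearity
    ([rho = iota]) and right linearity ([rho = nu]) together. *)
Definition Vlin (psi : V -> K) : Prop :=
  (forall u v, psi (tadd u v) = psi u + psi v) /\
  (forall c u v, proj1_sig v = rho c * proj1_sig u -> psi v = c * psi u).

Lemma Vlin_mul psi e : Vlin psi -> Vlin (fun x => psi (Vmul e x)).
Proof.
move=> [psiD psiZ]; split=> [u v|c u v vE].
  by rewrite -psiD; congr psi; apply: Vcar_eq; rewrite /= mulrDr.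
by apply: psiZ; rewrite /= vE mulrCA.
Qed.

Lemma Vlin_sum psi (I : Type) (r : seq I) (c : I -> K) (w : I -> V) v : Vlin psi ->
  proj1_sig v = \sum_(i <- r) rho (c i) * proj1_sig (w i) ->
  psi v = \sum_(i <- r) c i * psi (w i).
Proof.
move=> [psiD psiZ]; elim: r v => [|i r IHr] v.
  rewrite !big_nil => v0; rewrite (psiZ 0 v v) ?mul0r //.
  by rewrite v0 mulr0.
rewrite !big_cons => vE.
pose u : V := exist _ _ (CM (Crho (c i)) (proj2_sig (w i))).
have Ct : C (\sum_(j <- r) rho (c j) * proj1_sig (w j)).
  elim/big_ind: _ => [|x y|j _]; [exact: C0 | exact: CD |].
  exact: CM (Crho _) (proj2_sig (w j)).
rewrite -(IHr (exist _ _ Ct)) // -(psiZ (c i) (w i) u) // -psiD.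
by congr psi; apply: Vcar_eq.
Qed.

(** Take for [phi] the first coordinate in the basis [b]; its Gram matrix
    [phi (b i * b j)] is invertible because [C] is a field. *)
Lemma functional_generator n (b : 'I_n -> L) : basis_over rho C b ->
  exists phi : V -> K, [/\ Vlin phi,
    forall e, (forall x, phi (Vmul e x) = 0) -> proj1_sig e = 0 &
    forall psi, Vlin psi -> exists e, forall x, psi x = phi (Vmul e x)].
Proof.
case: n b => [|n] b bB; have [Cb spanb freeb] := bB.
  have [c /eqP] := spanb 1 (fun P P_field _ _ => let: And5 _ P1 _ _ _ := P_field in P1).
  by rewrite big_ord0 oner_eq0.
have [crd crdE] := choice (fun v : V => spanb _ (proj2_sig v)).
have crd_uniq v d : proj1_sig v = \sum_i rho (d i) * b i -> forall i, crd v i = d i.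
  by move=> vE; apply: (basis_over_inj bB); rewrite -crdE.
pose B i : V := exist _ _ (Cb i).
pose phi v := crd v ord0.
have phi_lin : Vlin phi.
  split=> [u v|c u v vE].
    apply: (crd_uniq _ (fun i => crd u i + crd v i)); rewrite /= (crdE u) (crdE v).
    by rewrite -big_split; apply: eq_bigr => i _; rewrite rmorphD mulrDl.
  apply: (crd_uniq _ (fun i => c * crd u i)); rewrite vE (crdE u) mulr_sumr.
  by apply: eq_bigr => i _; rewrite rmorphM mulrA.
have phi_nondeg e : (forall x, phi (Vmul e x) = 0) -> proj1_sig e = 0.
  move=> phi0; apply/eqP/negPn/negP=> e0.
  (* This is e^-1 b_0: its product with [e] is the first basis vector, where [phi] is 1. *)
  pose x : V := exist _ _ (CM (in_compV (proj2_sig e)) (Cb ord0)).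
  have := phi0 x; rewrite /phi (crd_uniq _ (fun i => (i == ord0)%:R)) => [/eqP|].
    by rewrite /= ?eqxx oner_eq0.
  rewrite /= mulVKf // (bigD1 ord0) //= ?eqxx rmorph1 mul1r big1 ?addr0 // => i /negPf ->.
  by rewrite rmorph0 mul0r.
exists phi; split=> // psi psi_lin.
have CE (c : 'I_n.+1 -> K) : C (\sum_i rho (c i) * b i).
  by elim/big_ind: _ => [|x y|j _]; [exact: C0 | exact: CD | exact: CM (Crho _) (Cb j)].
pose E c : V := exist _ _ (CE c).
pose G := \matrix_(i, j) phi (Vmul (B i) (B j)).
have phiE c x : phi (Vmul (E c) x) = \sum_i c i * phi (Vmul (B i) x).
  apply: Vlin_sum => //=; rewrite mulr_suml.
  by apply: eq_bigr => i _; rewrite mulrA.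
(* A row killed by [G] gives an element of [C] whose products with the basis, hence with all of [C],
   lie in the kernel of [phi]; nondegeneracy makes it 0. *)
have GU : G \in unitmx.
  rewrite -row_free_unit; apply: inj_row_free => v vG.
  have e0 : proj1_sig (E (v 0)) = 0.
    apply: phi_nondeg => x.
    rewrite (Vlin_sum (Vlin_mul (E (v 0)) phi_lin) (w := B) (crdE x)).
    rewrite big1 // => j _; rewrite phiE.
    have /matrixP/(_ 0 j) := vG; rewrite !mxE => vGj.
    rewrite [X in _ * X](_ : _ = 0) ?mulr0 // -[RHS]vGj.
    by apply: eq_bigr => i _; rewrite [in RHS]mxE.
  by apply/matrixP=> i j; rewrite (ord1 i) [RHS]mxE; apply: freeb.
(* With this solution of c G = (psi(b_j))_j, [psi] and the multiple of [phi] by [E (c 0)] agree on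
   the basis. *)
pose c := (\row_j psi (B j)) *m invmx G.
exists (E (c 0)) => x.
rewrite (Vlin_sum (Vlin_mul (E (c 0)) phi_lin) (w := B) (crdE x)).
rewrite (Vlin_sum psi_lin (w := B) (crdE x)); apply: eq_bigr => j _; congr (_ * _).
rewrite phiE; have /matrixP/(_ 0 j) : c *m G = \row_j psi (B j) by rewrite mulmxKV.
rewrite [X in _ = X -> _]mxE [X in X = _ -> _]mxE => <-.
by apply: eq_bigr => i _; congr (_ * _); rewrite mxE.
Qed.

End Functionals.

Lemma sig_eq (T : Type) (P : T -> Prop) (u v : {x | P x}) :
  proj1_sig u = proj1_sig v -> u = v.
Proof. by case: u v => x hx [y hy] /= e; subst y; congr exist; apply: Prop_irrelevance. Qed.

(** * Transport along [lamb] from K(mu) to K(lam) *)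

Section Twist.
Variables (K : fieldType) (L : closedFieldType) (iota lam mu : {rmorphism K -> L}).
Variable lamb : {rmorphism L -> L}.
Hypotheses (lamb_iota : forall a, lamb (iota a) = lam a)
           (lamb_mu : forall a, lamb (mu a) = iota a).

(** The preimage under [lamb] of a subfield containing [iota K] and [lam K] is a subfield containing
    [mu K] and [iota K]. *)
Lemma in_comp_twist x : in_comp iota mu x -> in_comp iota lam (lamb x).
Proof.
move=> Cx P [P0 P1 PB PM PV] Pi Pl; apply: (Cx (fun x => P (lamb x))) => [|a|a].
- split=> [||y z|y z|y]; rewrite ?rmorph0 ?rmorph1 ?rmorphB ?rmorphM ?fmorphV //.
  + exact: PB.
  + exact: PM.
  + exact: PV.
- by rewrite lamb_iota.
- by rewrite lamb_mu.
Qed.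

Lemma in_comp_untwist z : in_comp iota lam z -> exists2 x, in_comp iota mu x & lamb x = z.
Proof.
move=> Cz; apply: (Cz (fun z => exists2 x, in_comp iota mu x & lamb x = z)) => [|a|a].
- split.
  + by exists 0; [exact: C0 | rewrite rmorph0].
  + by exists 1; [rewrite -(rmorph1 iota); exact: Ciota | rewrite rmorph1].
  + move=> _ _ [x Cx <-] [y Cy <-]; exists (x - y); last by rewrite rmorphB.
    by apply: CD => //; rewrite -mulN1r -(rmorph1 iota) -rmorphN; apply: CM (Ciota _) _.
  + by move=> _ _ [x Cx <-] [y Cy <-]; exists (x * y); [exact: CM | rewrite rmorphM].
  + by move=> _ [x Cx <-]; exists x^-1; [exact: in_compV | rewrite fmorphV].
- by exists (mu a); [exact: Cnu | rewrite lamb_mu].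
- by exists (iota a); [exact: Ciota | rewrite lamb_iota].
Qed.

(** [lamb] is a bijection from K(mu) onto K(lam) turning [rho]-scalars into [sigma]-scalars. The
    pairs of interest are ([mu], [iota]) and ([iota], [lam]). *)
Lemma basis_over_twist (rho sigma : K -> L) n : (forall a, lamb (rho a) = sigma a) ->
  (exists b : 'I_n -> L, basis_over rho (in_comp iota mu) b) <->
  (exists b : 'I_n -> L, basis_over sigma (in_comp iota lam) b).
Proof.
move=> rs.
have lamb_sum (b : 'I_n -> L) (c : 'I_n -> K) :
    lamb (\sum_i rho (c i) * b i) = \sum_i sigma (c i) * lamb (b i).
  by rewrite rmorph_sum; apply: eq_bigr => i _; rewrite rmorphM rs.
split=> [[b [Cb spanb freeb]]|[b' [Cb spanb freeb]]].
  exists (fun i => lamb (b i)); split=> [i|z /in_comp_untwist[x Cx <-]|c c0].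
  - exact: in_comp_twist.
  - by have [c ->] := spanb x Cx; exists c; rewrite lamb_sum.
  - by apply: freeb; apply: (fmorph_inj lamb); rewrite lamb_sum rmorph0.
have [|b bE] := @choice _ _ (fun i x => in_comp iota mu x /\ lamb x = b' i).
  by move=> i; have [x Cx xb] := in_comp_untwist (Cb i); exists x.
have lamb_sum' c : lamb (\sum_i rho (c i) * b i) = \sum_i sigma (c i) * b' i.
  by rewrite lamb_sum; apply: eq_bigr => i _; rewrite (bE i).2.
exists b; split=> [i|x Cx|c c0]; first exact: (bE i).1.
- have [c xE] := spanb _ (in_comp_twist Cx); exists c.
  by apply: (fmorph_inj lamb); rewrite lamb_sum'.
- by apply: freeb; rewrite -lamb_sum' c0 rmorph0.
Qed.

(** Exchanges the two actions: iota(a) w mu(b) goes to lam(a) lamb(w) iota(b). *)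
Definition twist (w : Vnu iota mu) : Vnu iota lam :=
  exist _ _ (in_comp_twist (proj2_sig w)).

Lemma twist_inj : injective twist.
Proof. by move=> u v /(congr1 (@proj1_sig _ _))/fmorph_inj /Vcar_eq. Qed.

Lemma twist_surj v : exists w, twist w = v.
Proof.
case: v => z Cz; have [x Cx xz] := in_comp_untwist Cz.
by exists (exist _ x Cx); apply: Vcar_eq.
Qed.

Section Generator.
Variables (rho : {rmorphism K -> L}) (phi : Vnu iota lam -> K).
Hypotheses (phi_lin : Vlin rho phi)
  (phi_nondeg : forall e, (forall x, phi (Vmul e x) = 0) -> proj1_sig e = 0)
  (phi_gen : forall psi, Vlin rho psi -> exists e, forall x, psi x = phi (Vmul e x)).

Lemma phi_mul_inj e e' : (forall x, phi (Vmul e x) = phi (Vmul e' x)) -> e = e'.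
Proof.
have [phiD phiZ] := phi_lin => ee'.
(* The record [tsv] has no opposite, so e - e' is formed with the action of -1. *)
pose d : Vnu iota lam := tadd e (tl (-1) e').
suff : proj1_sig d = 0.
  move/eqP; rewrite /= rmorphN1 mulN1r subr_eq0 => /eqP; exact: Vcar_eq.
apply: phi_nondeg => x; have -> : Vmul d x = tadd (Vmul e x) (tl (-1) (Vmul e' x)).
  by apply: Vcar_eq; rewrite /= mulrDl mulrA.
rewrite phiD ee' (phiZ (-1) (Vmul e' x) (tl (-1) (Vmul e' x))) ?mulN1r ?subrr //.
by rewrite /= !rmorphN1.
Qed.

(** The map sends [w] to x |-> phi(twist(w) x), bijectively since [phi] generates the functionals
    freely. The left action matches because [phi] is [lam]-linear; on the right, [twist] turns mu(b)
    into the factor iota(b) that the dual puts on the argument. *)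
Lemma rdual_twist_iso : rho =1 lam ->
  tsv_iso (rdual (Vnu_compat iota lam)) (Vnu iota mu).
Proof.
move=> rhoE; have [phiD phiZ] := phi_lin.
have rlinP (psi : Vnu iota lam -> K) : rlin psi <-> Vlin rho psi.
  split=> -[psiD psiZ]; split=> //; [move=> c u v vE | move=> v b].
    by rewrite mulrC -psiZ; congr psi; apply: Vcar_eq; rewrite /= vE mulrC rhoE.
  by rewrite mulrC; apply: psiZ; rewrite /= mulrC rhoE.
have glin w : rlin (fun x => phi (Vmul (twist w) x)) by apply/rlinP/Vlin_mul.
apply: (bij_tsv_iso (g := fun w => exist _ _ (glin w) : rdual _)).
- move=> u v /(congr1 (@proj1_sig _ _)) /= uv; apply/twist_inj/phi_mul_inj => x.
  exact: (congr1 (fun F : Vnu iota lam -> K => F x) uv).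
- move=> [psi psi_lin]; have [e eE] := phi_gen ((rlinP psi).1 psi_lin).
  by have [w wE] := twist_surj e; exists w; apply/sig_eq/funext => x /=; rewrite eE wE.
- move=> u v; apply/sig_eq/funext => x /=; rewrite -phiD; congr phi.
  by apply: Vcar_eq; rewrite /= rmorphD mulrDl.
- move=> a v; apply/sig_eq/funext => x /=; apply: phiZ.
  by rewrite /= rmorphM lamb_iota rhoE mulrA.
- move=> v b; apply/sig_eq/funext => x /=; congr phi.
  by apply: Vcar_eq; rewrite /= rmorphM lamb_mu mulrA.
Qed.

(** Same map with an [iota]-linear [phi]: now the right action comes from linearity, and the left
    one from the factor lam(a) on the argument. *)
Lemma ldual_twist_iso : rho =1 iota ->
  tsv_iso (ldual (Vnu_compat iota lam)) (Vnu iota mu).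
Proof.
move=> rhoE; have [phiD phiZ] := phi_lin.
have llinP (psi : Vnu iota lam -> K) : llin psi <-> Vlin rho psi.
  split=> -[psiD psiZ]; split=> //; [move=> c u v vE | move=> c v].
    by rewrite -psiZ; congr psi; apply: Vcar_eq; rewrite /= vE rhoE.
  by apply: psiZ; rewrite /= rhoE.
have glin w : llin (fun x => phi (Vmul (twist w) x)) by apply/llinP/Vlin_mul.
apply: (bij_tsv_iso (g := fun w => exist _ _ (glin w) : ldual _)).
- move=> u v /(congr1 (@proj1_sig _ _)) /= uv; apply/twist_inj/phi_mul_inj => x.
  exact: (congr1 (fun F : Vnu iota lam -> K => F x) uv).
- move=> [psi psi_lin]; have [e eE] := phi_gen ((llinP psi).1 psi_lin).
  by have [w wE] := twist_surj e; exists w; apply/sig_eq/funext => x /=; rewrite eE wE.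
- move=> u v; apply/sig_eq/funext => x /=; rewrite -phiD; congr phi.
  by apply: Vcar_eq; rewrite /= rmorphD mulrDl.
- move=> a v; apply/sig_eq/funext => x /=; congr phi.
  by apply: Vcar_eq; rewrite /= rmorphM lamb_iota [RHS]mulrA [RHS]mulrC mulrA.
- move=> v b; apply/sig_eq/funext => x /=; apply: phiZ.
  by rewrite /= rmorphM lamb_mu rhoE [RHS]mulrA [_ * iota b]mulrC.
Qed.

End Generator.
End Twist.

(** * Duals and rank of V(lam) *)

Theorem theorem3p13
  (k K : fieldType) (kK : {rmorphism k -> K})
  (Kbar : closedFieldType) (iota : {rmorphism K -> Kbar})
  (Hclos : is_algebraic_closure iota)
  (Hperf : perfect K)
  (lam : {rmorphism K -> Kbar}) (Hlam : is_k_emb kK iota lam)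
  (n : nat) (Horb : orbit_card iota lam n)
  (lamb : {rmorphism Kbar -> Kbar}) (Hext : forall a : K, lamb (iota a) = lam a)
  (mu : {rmorphism K -> Kbar}) (Hmu : forall a : K, lamb (mu a) = iota a)
  (Hfin : finite_degree (in_image lam) (in_comp iota lam)) :
  tsv_iso (ldual (Vnu_compat iota lam)) (rdual (Vnu_compat iota lam)) /\
  tsv_iso (rdual (Vnu_compat iota lam)) (Vnu iota mu) /\
  (has_rank (Vnu iota lam) n <-> has_rank (Vnu iota mu) n) /\
  (has_rank (Vnu iota mu) n <-> ext_degree (in_image lam) (in_comp iota lam) n).
Proof.
have [b bB] := orbit_basis Hclos Hperf Horb.
(* The left dimension of V(lam) and the right dimension of V(mu) are both [K(lam) : K] = n. The
   other two are both [K(lam) : lam(K)], so each rank condition reduces to that degree being [n]. *)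
have ldim_lam : ldim_eq (Vnu iota lam) n by apply/ldim_VnuP; exists b.
have rdim_mu : rdim_eq (Vnu iota mu) n.
  by apply/rdim_VnuP/(basis_over_twist Hext Hmu n Hmu)/ldim_VnuP.
have ldim_mu : ldim_eq (Vnu iota mu) n <-> ext_degree (in_image lam) (in_comp iota lam) n.
  rewrite ldim_VnuP ext_degreeP; exact: basis_over_twist.
have rdim_lam : rdim_eq (Vnu iota lam) n <-> ext_degree (in_image lam) (in_comp iota lam) n.
  by rewrite rdim_VnuP ext_degreeP.
have isoR : tsv_iso (rdual (Vnu_compat iota lam)) (Vnu iota mu).
  (* The right dual takes its functional from a basis over [lam K]; the left dual uses the orbit
     basis over [K]. *)
  have [d /ext_degreeP[b' b'B]] := Hfin.
  have [phi [phi_lin nondeg gen]] := functional_generator (@Cnu _ _ iota lam) b'B.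
  exact: rdual_twist_iso phi_lin nondeg gen _.
have isoL : tsv_iso (ldual (Vnu_compat iota lam)) (Vnu iota mu).
  have [phi [phi_lin nondeg gen]] := functional_generator (@Ciota _ _ iota lam) bB.
  exact: ldual_twist_iso phi_lin nondeg gen _.
split; first exact: tsv_iso_trans isoL (tsv_iso_sym isoR).
by split=> //; split; split=> [[]|] //; rewrite /has_rank; tauto.
Qed.
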